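(* Let $A\in\mathbb{R}^{m\times n}$, let $B\in\mathbb{R}^{n\times n}$ be symmetric positive definite, and let $S$ be a random matrix with finite discrete distribution: $S=S_i$ with probability $p_i>0$, $i=1,\dots,r$, $\sum_{i=1}^rp_i=1$, where $S_1,\dots,S_r$ are fixed real matrices each with $m$ rows. Then the matrix $$H=\mathbf{E}\left[S\left(S^\top AB^{-1}A^\top S\right)^\dagger S^\top\right]$$ is nonsingular if and only if $$\mathrm{Range}\left([S_1S_1^\top A,\ \cdots,\ S_rS_r^\top A]\right)=\mathbb{R}^m .$$
   Context: $\dagger$ denotes the Moore–Penrose pseudoinverse. $[M_1,\dots,M_r]$ denotes horizontal concatenation of matrices and $\mathrm{Range}$ the column space. *)

(* Defs.v *)
From HB Require Import structures.
From mathcomp Require Import all_boot all_order all_algebra.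
From mathcomp Require Import boolp classical_sets reals ereal measure probability.
Set Implicit Arguments. Unset Strict Implicit. Unset Printing Implicit Defensive.
Import Order.TTheory GRing.Theory Num.Theory.
Local Open Scope ring_scope.

Definition posdefmx (F : realFieldType) (n : nat) (B : 'M[F]_n) : Prop :=
  forall x : 'cV[F]_n, x != 0 -> 0 < (x^T *m B *m x) 0 0.

Section MoorePenrose.
Variable F : realFieldType.

(* The four Penrose equations; over a real field the adjoint is the
   transpose. *)
Definition penrose (m n : nat) (M : 'M[F]_(m, n)) (X : 'M[F]_(n, m)) : bool :=
  [&& M *m X *m M == M, X *m M *m X == X,
      (M *m X)^T == M *m X & (X *m M)^T == X *m M].

Lemma gram_unitmx (m n : nat) (C : 'M[F]_(m, n)) :
  \rank C = n -> C^T *m C \in unitmx.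
Proof.
move=> rC; rewrite -row_free_unit -kermx_eq0; apply/eqP/row_matrixP => i.
rewrite row0; set v := row i _.
have v0 : v *m (C^T *m C) = 0.
  by apply/eqP; rewrite -sub_kermx row_sub.
have : (v *m C^T) *m (v *m C^T)^T = 0.
  by rewrite trmx_mul trmxK mulmxA -(mulmxA v) v0 mul0mx.
move uE: (v *m C^T) => u /matrixP/(_ 0 0)/eqP.
rewrite !mxE psumr_eq0 => [/allP h|j _]; last by rewrite mxE -expr2 sqr_ge0.
have u0 : u = 0.
  apply/rowP => j; have := h j (mem_index_enum j).
  by rewrite mxE mulf_eq0 orbb mxE => /eqP.
have fC : row_free C^T by rewrite /row_free mxrank_tr rC.
by apply: (row_free_inj fC); rewrite uE u0 mul0mx.
Qed.

Lemma penrose_mul (m k n : nat) (C : 'M[F]_(m, k)) (D : 'M[F]_(k, n)) :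
  \rank C = k -> \rank D = k ->
  penrose (C *m D) (D^T *m invmx (D *m D^T) *m invmx (C^T *m C) *m C^T).
Proof.
move=> rC rD; have uC := gram_unitmx rC.
have uD : D *m D^T \in unitmx.
  by rewrite -{1}(trmxK D); apply: gram_unitmx; rewrite mxrank_tr.
set G := invmx (C^T *m C); set K := invmx (D *m D^T).
have GC : G *m (C^T *m C) = 1%:M by rewrite mulVmx.
have DK : D *m D^T *m K = 1%:M by rewrite mulmxV.
have sG : G^T = G by rewrite /G trmx_inv trmx_mul trmxK.
have sK : K^T = K by rewrite /K trmx_inv trmx_mul trmxK.
set X := D^T *m K *m G *m C^T.
have MX : C *m D *m X = C *m G *m C^T.
  rewrite /X !mulmxA; congr (_ *m _ *m _).
  by rewrite -!mulmxA (mulmxA D) DK mulmx1.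
have XM : X *m (C *m D) = D^T *m K *m D.
  rewrite /X mulmxA; congr (_ *m _).
  by rewrite -!mulmxA GC mulmx1.
apply/and4P; split; apply/eqP.
- by rewrite MX mulmxA; congr (_ *m _); rewrite -!mulmxA GC mulmx1.
- rewrite XM /X !mulmxA; congr (_ *m _ *m _).
  by rewrite -!mulmxA (mulmxA D) DK mulmx1.
- by rewrite MX !trmx_mul trmxK sG mulmxA.
- by rewrite XM !trmx_mul trmxK sK mulmxA.
Qed.

Lemma penrose_exists (m n : nat) (M : 'M[F]_(m, n)) : exists X, penrose M X.
Proof.
rewrite -(mulmx_base M); eexists; apply: penrose_mul; apply/eqP.
  by rewrite -/(row_full _) col_base_full.
exact: row_base_free.
Qed.

Definition mppinv (m n : nat) (M : 'M[F]_(m, n)) : 'M[F]_(n, m) :=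
  xchoose (penrose_exists M).

Lemma mppinvP (m n : nat) (M : 'M[F]_(m, n)) : penrose M (mppinv M).
Proof. exact: xchooseP. Qed.

Lemma penrose_unique (m n : nat) (M : 'M[F]_(m, n)) (X Y : 'M[F]_(n, m)) :
  penrose M X -> penrose M Y -> X = Y.
Proof.
move=> /and4P[/eqP x1 /eqP x2 /eqP x3 /eqP x4].
move=> /and4P[/eqP y1 /eqP y2 /eqP y3 /eqP y4].
have e1 : M *m X = M *m Y.
  by rewrite -x3 -{1}y1 -mulmxA trmx_mul y3 x3 mulmxA x1.
have e2 : X *m M = Y *m M.
  by rewrite -x4 -{1}y1 -(mulmxA M) mulmxA trmx_mul x4 y4 -mulmxA (mulmxA M) x1.
by rewrite -x2 e2 -mulmxA e1 mulmxA y2.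
Qed.

End MoorePenrose.

Local Open Scope classical_set_scope.

(* Real matrices with m rows and an unspecified number of columns. *)
Definition sketchmx (R : realType) (m : nat) : Type :=
  {k : nat & 'M[R]_(m, k)}.

Definition sketch (R : realType) (m k : nat) (M : 'M[R]_(m, k)) :
  sketchmx R m := existT (fun k => 'M[R]_(m, k)) k M.

(* S has the law p_0 delta_(S_0) + ... + p_(r-1) delta_(S_(r-1)).  When the S_i
   are pairwise distinct this says P(S = S_i) = p_i; the weights of coinciding
   S_i add up.  If the p_i sum to 1, S takes other values only on a null set. *)
Definition has_discrete_law (R : realType) (m r : nat) (d : measure_display)
    (T : measurableType d) (P : probability T R) (S : T -> sketchmx R m)
    (Si : 'I_r -> sketchmx R m) (p : 'I_r -> R) : Prop :=
  forall M : sketchmx R m,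
    measurable (S @^-1` [set M]) /\
    P (S @^-1` [set M]) = (\sum_(i < r | `[< Si i = M >]) p i)%:E.

Definition expectation_mx (R : realType) (m n : nat) (d : measure_display)
    (T : measurableType d) (P : probability T R) (X : T -> 'M[R]_(m, n)) :
    'M[R]_(m, n) :=
  \matrix_(i, j) fine 'E_P[fun w => X w i j].

(* Main.v *)
Require Import Defs.
From mathcomp Require Import all_boot all_order all_algebra.
From mathcomp Require Import boolp classical_sets reals ereal measure probability.
From mathcomp Require Import functions numfun measurable_realfun lebesgue_integral.
Import Order.TTheory GRing.Theory Num.Theory.
Local Open Scope classical_set_scope.
Local Open Scope ring_scope.
Set Implicit Arguments. Unset Strict Implicit. Unset Printing Implicit Defensive.

(* Each [Z_i = S_i (S_i^T A B^-1 A^T S_i)^+ S_i^T] is positive semidefinite, and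
   since a symmetric matrix has the same kernel as its pseudoinverse,
   [v Z_i v^T = 0] iff [v S_i S_i^T A = 0].  As [H] is the combination of the
   [Z_i] with positive weights [p_i], its left kernel is the common left kernel
   of the [S_i S_i^T A], i.e. that of their concatenation. *)

(** * Kernels of positive definite forms, of pseudoinverses and of the terms [Z_i] *)

Section LinearAlgebra.
Variable F : realFieldType.

Lemma row_free_ker (m n : nat) (M : 'M[F]_(m, n)) :
  row_free M <-> forall v : 'rV_m, v *m M = 0 -> v = 0.
Proof.
split=> [fM v vM0|kM]; first by apply/eqP; rewrite -(mulmx_free_eq0 v fM) vM0.
rewrite -kermx_eq0; apply/eqP/row_matrixP => i; rewrite row0.
by apply: kM; apply/eqP; rewrite -sub_kermx row_sub.
Qed.

Lemma posdefmx_unit (n : nat) (B : 'M[F]_n) : posdefmx B -> B \in unitmx.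
Proof.
move=> Bpos; rewrite -row_free_unit; apply/row_free_ker => v vB0.
apply/eqP; case: (eqVneq v 0) => // v0.
have /Bpos : v^T != 0 by rewrite trmx_eq0.
by rewrite trmxK vB0 mul0mx mxE ltxx.
Qed.

Lemma posdefmx_inv (n : nat) (B : 'M[F]_n) :
  B^T = B -> posdefmx B -> posdefmx (invmx B).
Proof.
move=> Bsym Bpos x x0; have uB := posdefmx_unit Bpos.
have -> : x^T *m invmx B *m x = (invmx B *m x)^T *m B *m (invmx B *m x).
  by rewrite trmx_mul trmx_inv Bsym -!mulmxA (mulmxA B) mulmxV// mul1mx.
apply: Bpos; apply: contra_neq x0 => /(congr1 (mulmx B)).
by rewrite mulmxA mulmxV// mul1mx mulmx0.
Qed.

Lemma posdefmx_ge0 (n : nat) (C : 'M[F]_n) (x : 'cV_n) :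
  posdefmx C -> 0 <= (x^T *m C *m x) 0 0.
Proof.
move=> Cpos; have [->|/Cpos/ltW//] := eqVneq x 0.
by rewrite mulmx0 mxE.
Qed.

Lemma posdefmx_eq0 (n : nat) (C : 'M[F]_n) (x : 'cV_n) :
  posdefmx C -> (x^T *m C *m x) 0 0 = 0 -> x = 0.
Proof.
by move=> Cpos xCx; apply/eqP; apply: contra_eqT xCx => /Cpos /gt_eqF ->.
Qed.

(** Transposing the Penrose equations of a symmetric [G] permutes them, so the transpose is again a
    pseudoinverse of [G], and uniqueness applies. *)
Lemma mppinv_sym (k : nat) (G : 'M[F]_k) : G^T = G -> (mppinv G)^T = mppinv G.
Proof.
move=> Gsym; have /and4P[/eqP e1 /eqP e2 /eqP e3 /eqP e4] := mppinvP G.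
apply: (@penrose_unique _ _ _ G); last exact: mppinvP.
have e3' : (mppinv G)^T *m G = G *m mppinv G by rewrite -e3 trmx_mul Gsym.
have e4' : G *m (mppinv G)^T = mppinv G *m G by rewrite -e4 trmx_mul Gsym.
apply/and4P; split; apply/eqP.
- by rewrite -[RHS]Gsym -[in RHS]e1 !trmx_mul Gsym mulmxA.
- by rewrite -[in RHS]e2 !trmx_mul Gsym mulmxA.
- by rewrite e4' e4.
- by rewrite e3' e3.
Qed.

Lemma mppinv_comm (k : nat) (G : 'M[F]_k) :
  G^T = G -> G *m mppinv G = mppinv G *m G.
Proof.
move=> Gsym; have /and4P[_ _ /eqP e3 _] := mppinvP G.
by rewrite -e3 trmx_mul Gsym mppinv_sym.
Qed.

(** Write X for the pseudoinverse. As G and X commute, G = GXG = GGX and X = XGX = XXG, so each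
    matrix factors through the other on the right. *)
Lemma mppinv_ker (k : nat) (G : 'M[F]_k) (v : 'cV_k) :
  G^T = G -> (mppinv G *m v = 0) <-> (G *m v = 0).
Proof.
move=> Gsym; have /and4P[/eqP e1 /eqP e2 _ _] := mppinvP G.
have GX := mppinv_comm Gsym.
split=> v0.
  by rewrite -e1 -(mulmxA G) -GX -!mulmxA v0 !mulmx0.
by rewrite -e2 -(mulmxA (mppinv G)) GX -!mulmxA v0 !mulmx0.
Qed.

Section SketchTerm.
Variables (m n k : nat) (A : 'M[F]_(m, n)) (C : 'M[F]_n) (S : 'M[F]_(m, k)).
Hypotheses (Csym : C^T = C) (Cpos : posdefmx C).

Let G := S^T *m A *m C *m A^T *m S.
Definition sketch_term := S *m mppinv G *m S^T.

Let Gsym : G^T = G.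
Proof. by rewrite /G !trmx_mul !trmxK Csym !mulmxA. Qed.

Let G_ker (v : 'cV_k) : G *m v = 0 <-> A^T *m S *m v = 0.
Proof.
split=> [Gv0|Av0]; last first.
  by rewrite /G -!mulmxA (mulmxA A^T) Av0 !mulmx0.
(* [G] is the form [C] pulled back along [A^T *m S], so definiteness of [C] recovers the vector from
   its quadratic value. *)
apply: (posdefmx_eq0 Cpos).
have -> : (A^T *m S *m v)^T *m C *m (A^T *m S *m v) = v^T *m (G *m v).
  by rewrite !trmx_mul trmxK /G !mulmxA.
by rewrite Gv0 mulmx0 mxE.
Qed.

(** Replacing X by XGX, with X the pseudoinverse of [G], exposes the factor [C] inside [G] and makes
    the term a congruence of [C]. *)
Let formE (v : 'rV_m) (w := A^T *m S *m (mppinv G *m (S^T *m v^T))) :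
  v *m sketch_term *m v^T = w^T *m C *m w.
Proof.
have /and4P[_ /eqP e2 _ _] := mppinvP G.
by rewrite /sketch_term -{1}e2 /w !trmx_mul !trmxK mppinv_sym// !mulmxA.
Qed.

Lemma sketch_term_ge0 (v : 'rV_m) : 0 <= (v *m sketch_term *m v^T) 0 0.
Proof. by rewrite formE posdefmx_ge0. Qed.

Let pinv_ker (v : 'rV_m) :
  mppinv G *m (S^T *m v^T) = 0 <-> v *m (S *m S^T *m A) = 0.
Proof.
rewrite mppinv_ker// G_ker.
have -> : A^T *m S *m (S^T *m v^T) = (v *m (S *m S^T *m A))^T.
  by rewrite !trmx_mul trmxK !mulmxA.
by split=> [/(congr1 trmx)|->]; rewrite ?trmxK trmx0.
Qed.

Lemma sketch_term_ker (v : 'rV_m) :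
  v *m (S *m S^T *m A) = 0 -> v *m sketch_term = 0.
Proof.
move=> /pinv_ker Xv0; apply: trmx_inj; rewrite trmx0.
by rewrite !trmx_mul mppinv_sym// trmxK -!mulmxA Xv0 mulmx0.
Qed.

Lemma sketch_term_eq0 (v : 'rV_m) :
  (v *m sketch_term *m v^T) 0 0 = 0 -> v *m (S *m S^T *m A) = 0.
Proof.
rewrite formE => /(posdefmx_eq0 Cpos)/G_ker Gu0.
have /and4P[_ /eqP e2 _ _] := mppinvP G.
(* So far only GXu = 0 is known, for u the transpose of [v *m S]; X = XGX turns this into Xu = 0. *)
apply/pinv_ker; rewrite -{1}e2 -(mulmxA (mppinv G)).
by rewrite -(mulmxA (mppinv G)) -(mulmxA G) Gu0 mulmx0.
Qed.

End SketchTerm.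
End LinearAlgebra.

(** * Integrals under changes on a null set, then expectations under a finite law *)

Section NullSetModification.
Local Open Scope ereal_scope.
Context d (T : measurableType d) (R : realType) (mu : {measure set T -> \bar R}).
Variables (N : set T) (mN : measurable N) (muN0 : mu N = 0).

(* No measurability is assumed, unlike in [ge0_le_integral]. *)
Lemma ge0_le_integralT (f g : T -> \bar R) :
  (forall x, 0 <= f x) -> (forall x, f x <= g x) ->
  \int[mu]_x f x <= \int[mu]_x g x.
Proof.
move=> f0 fg; have g0 x : 0 <= g x by exact: le_trans (fg x).
rewrite !ge0_integralTE//; apply: ereal_sup_le => _ [h /= hf <-].
by exists h => // x; exact: le_trans (fg x).
Qed.

Lemma ge0_integral_eq_off_null (f g : T -> \bar R) :
  measurable_fun setT g -> (forall x, 0 <= f x) -> (forall x, 0 <= g x) ->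
  (forall x, ~ N x -> f x = g x) -> \int[mu]_x f x = \int[mu]_x g x.
Proof.
move=> mg f0 g0 fg; apply/eqP; rewrite eq_le; apply/andP; split.
  (* Upper bound: [h] is a measurable majorant of [f], infinite on [N] and equal to [g] elsewhere,
     hence with the integral of [g]. *)
  pose h x := maxe (g x) (((cst +oo) \_ N) x).
  have hy x : N x -> h x = +oo.
    by move=> Nx; rewrite /h patchE mem_set// maxey.
  have hg x : ~ N x -> h x = g x.
    by move=> Nx; rewrite /h patchE memNset// max_l.
  have mh : measurable_fun setT h.
    apply: measurable_maxe => //.
    by apply/(measurable_restrictT _ _).1.
  apply: (@le_trans _ _ (\int[mu]_x h x)).
    apply: ge0_le_integralT => // x; have [Nx|Nx] := pselect (N x).
      by rewrite hy// leey.
    by rewrite hg// fg.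
  have h0 x : setT x -> 0 <= h x by rewrite le_max g0.
  rewrite (ge0_negligible_integral mN measurableT mh h0 muN0).
  rewrite [leRHS](ge0_negligible_integral (N := N))//.
  by rewrite (eq_integral g)// => x; rewrite inE => -[_ /hg].
(* Lower bound: [g] set to 0 on [N] keeps its integral and lies below [f]. *)
rewrite (ge0_negligible_integral (N := N) _ _ mg)// integral_mkcond.
apply: ge0_le_integralT => x; rewrite patchE; case: ifPn => //.
by rewrite inE => -[_ Nx]; rewrite fg.
Qed.

(* [f] need not be measurable: the integrand of [H] is arbitrary on the null set
   where [S] leaves [{S_1, ..., S_r}]. *)
Lemma integral_eq_off_null (f g : T -> \bar R) :
  measurable_fun setT g -> (forall x, ~ N x -> f x = g x) ->
  \int[mu]_x f x = \int[mu]_x g x.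
Proof.
move=> mg fg; rewrite integralE [RHS]integralE; congr (_ - _).
  apply: ge0_integral_eq_off_null => // [|x Nx].
    exact: measurable_funepos.
  by rewrite !funeposE fg.
apply: ge0_integral_eq_off_null => // [|x Nx].
  exact: measurable_funeneg.
by rewrite !funenegE fg.
Qed.

End NullSetModification.

(** [U] carries no sigma-algebra, so [f \o X] may fail to be measurable. It agrees off a null set
    with a combination [s f] of indicators of the fibres [D i], which is integrated termwise. *)
Lemma expectation_finite_law (R : realType) (U : Type) (r : nat)
    (d : measure_display) (T : measurableType d) (P : probability T R)
    (X : T -> U) (x : 'I_r -> U) (p : 'I_r -> R) :
  (forall i, 0 < p i) -> \sum_(i < r) p i = 1 ->
  (forall u, measurable (X @^-1` [set u]) /\
     P (X @^-1` [set u]) = (\sum_(i < r | `[< x i = u >]) p i)%:E) ->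
  forall f : U -> R, 'E_P[f \o X]%E = (\sum_(i < r) p i * f (x i))%:E.
Proof.
move=> p_gt0 p_sum1 law f.
pose q u := \sum_(i < r | `[< x i = u >]) p i.
pose D i := X @^-1` [set x i].
have mD i : measurable (D i) by case: (law (x i)).
have PD i : P (D i) = (q (x i))%:E by case: (law (x i)).
have q_gt0 i : 0 < q (x i).
  rewrite /q (bigD1 i) ?asboolE//= ltr_pwDl// sumr_ge0// => j _; exact: ltW.
(* Dividing by [q (x i)] compensates for the repetitions among the [x i]. *)
pose s (h : U -> R) w := \sum_(i < r) p i / q (x i) * h (x i) * \1_(D i) w.
have sE h w k : X w = x k -> s h w = h (X w).
  move=> Xw; rewrite /s (bigID (fun i => `[< x i = x k >]))/= addrC big1 ?add0r.
    under eq_bigr => i /asboolP xi.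
      rewrite xi indicE mem_set ?mulr1; last by rewrite /D /= Xw xi.
      over.
    by rewrite -!mulr_suml -/(q (x k)) divff ?gt_eqF// mul1r Xw.
  move=> i /asboolPn xi; rewrite indicE memNset ?mulr0// /D /= Xw => /esym.
  exact: xi.
have intD i : P.-integrable setT (fun w => (\1_(D i) w)%:E).
  exact: integrable_indic.
have ints h i : P.-integrable setT
    (fun w => ((p i / q (x i) * h (x i))%:E * (\1_(D i) w)%:E)%E).
  exact: integrableZl.
have sI h : (\int[P]_w (s h w)%:E = (\sum_(i < r) p i * h (x i))%:E)%E.
  rewrite (eq_integral (fun w => \sum_(i < r)
      (p i / q (x i) * h (x i))%:E * (\1_(D i) w)%:E)%E); last first.
    by move=> w _; rewrite sumEFin.
  rewrite integral_sum// -sumEFin; apply: eq_bigr => i _.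
  rewrite integralZl// integral_indic// setIT.
  by rewrite [X in (_ * X)%E]PD -EFinM mulrAC divfK// gt_eqF.
have ms h : measurable_fun setT (EFin \o s h).
  apply/measurable_EFinP; apply: measurable_sum => i.
  by apply: measurable_funM => //; exact: measurable_indic.
pose N := ~` \bigcup_(i in setT) D i.
have mU : measurable (\bigcup_(i in setT) D i) by exact: fin_bigcup_measurable.
have mN : measurable N by exact: measurableC.
(* The indicator of the union of the fibres is [s (cst 1)], whose integral is the sum of the [p i],
   that is 1. *)
have PN0 : P N = 0.
  rewrite /N probability_setC// -(setIT (\bigcup_(i in setT) D i)).
  rewrite -integral_indic//.
  rewrite (_ : (\int[P]_w _ = 1)%E) ?subee//.
  transitivity (\int[P]_w (s (cst 1) w)%:E)%E.
    apply: eq_integral => w _; congr EFin.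
    have [[k _ wk]|nDw] := pselect ((\bigcup_(i in setT) D i) w).
      by rewrite indicE mem_set ?(sE _ _ k)//; exists k.
    rewrite indicE memNset// /s big1// => i _; rewrite indicE memNset ?mulr0//.
    by move=> Di; apply: nDw; exists i.
  by rewrite sI; under eq_bigr do rewrite mulr1; rewrite p_sum1.
rewrite unlock -sI.
apply: (integral_eq_off_null mN PN0 (ms f)) => w /contrapT[k _ wk].
by rewrite /= (sE _ _ k).
Qed.

(** * Invertibility of [H] against surjectivity of the concatenation *)

Theorem theorem28 (R : realType) (m n r : nat)
    (A : 'M[R]_(m, n)) (B : 'M[R]_n)
    (B_sym : B^T = B) (B_posdef : posdefmx B)
    (q : 'I_r -> nat) (Si : forall i : 'I_r, 'M[R]_(m, q i))
    (p : 'I_r -> R) (p_gt0 : forall i, 0 < p i) (p_sum1 : \sum_(i < r) p i = 1)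
    (d : measure_display) (T : measurableType d) (P : probability T R)
    (S : T -> sketchmx R m)
    (S_law : has_discrete_law P S (fun i => sketch (Si i)) p) :
  let H : 'M[R]_m :=
    expectation_mx P (fun w =>
      let Sw := projT2 (S w) in
      Sw *m mppinv (Sw^T *m A *m invmx B *m A^T *m Sw) *m Sw^T) in
  H \in unitmx <->
  range (fun x : 'cV[R]_(\sum_(i < r) n) =>
           (\mxrow_(i < r) (Si i *m (Si i)^T *m A)) *m x)
    = [set: 'cV[R]_m].
Proof.
move=> H; set C := invmx B; set W := \mxrow_(i < r) _.
have Csym : C^T = C by rewrite /C trmx_inv B_sym.
have Cpos : posdefmx C by exact: posdefmx_inv.
have HE : H = \sum_(i < r) p i *: sketch_term A C (Si i).
  apply/matrixP => a b; rewrite mxE summxE.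
  have /(_ (fun M : sketchmx R m => sketch_term A C (projT2 M) a b)) :=
    expectation_finite_law p_gt0 p_sum1 S_law.
  move=> /(congr1 fine) /= EH; apply: (etrans EH).
  by apply: eq_bigr => i _; rewrite [RHS]mxE.
have W_ker (v : 'rV_m) :
    v *m W = 0 <-> forall i, v *m (Si i *m (Si i)^T *m A) = 0.
  rewrite mul_mxrow; split=> [vW i|vW]; last first.
    by apply/mxrowP => i; rewrite mxrowK vW submxrow0.
  by rewrite -(mxrowK (fun i => v *m (Si i *m (Si i)^T *m A)) i) vW submxrow0.
have H_ker (v : 'rV_m) :
    v *m H = 0 <-> forall i, v *m (Si i *m (Si i)^T *m A) = 0.
  rewrite HE; split=> [vH i|vZ]; last first.
    rewrite mulmx_sumr big1// => i _.
    by rewrite -scalemxAr sketch_term_ker ?scaler0.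
  apply: (sketch_term_eq0 Csym Cpos).
  have /eqP : \sum_(i < r) p i * (v *m sketch_term A C (Si i) *m v^T) 0 0 = 0.
    transitivity ((v *m (\sum_(i < r) p i *: sketch_term A C (Si i)) *m v^T) 0 0).
      rewrite mulmx_sumr mulmx_suml summxE; apply: eq_bigr => j _.
      by rewrite -scalemxAr -scalemxAl [RHS]mxE.
    by rewrite vH mul0mx mxE.
  rewrite psumr_eq0 => [/allP/(_ i (mem_index_enum i))|j _].
    by rewrite mulf_eq0 gt_eqF//= => /eqP.
  by rewrite mulr_ge0 ?sketch_term_ge0// ltW.
(* [H] is square, so invertibility means a trivial left kernel, and [H] and [W] have the same left
   kernel. *)
have -> : H \in unitmx <-> row_free W.
  rewrite -row_free_unit; split=> /row_free_ker kM; apply/row_free_ker => v.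
    by move=> /W_ker/H_ker/kM.
  by move=> /H_ker/W_ker/kM.
(* A right inverse [Y] of [W] gives the preimage [Y *m y] of [y]. *)
split=> [/row_freeP[Y WY]|rW].
  by apply/seteqP; split=> // y _; exists (Y *m y) => //; rewrite mulmxA WY mul1mx.
(* Conversely, writing the j-th basis vector as [W *m x] shows that the j-th entry of [v] is
   [v *m W *m x], hence 0. *)
apply/row_free_ker => v vW; apply/rowP => j.
have [x _ Wx] : range (fun x : 'cV[R]_(\sum_(i < r) n) => W *m x) (delta_mx j 0).
  by rewrite rW.
have : v *m (W *m x) = 0 by rewrite mulmxA vW mul0mx.
by rewrite Wx -colE => /matrixP/(_ 0 0); rewrite !mxE.
Qed.
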